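(* Let $(\mathcal S,\mathcal A,P,r)$ be any finite MDP (general/multichain) and $(g^\star,h^\star)$ a solution of the modified Bellman equations. Let $V^0\in\mathbb R^n$, let $0<\lambda_j<1$ for $j\ge1$ with $\limsup_j\lambda_j<1$, let $V^k=\lambda_kV^{k-1}+(1-\lambda_k)TV^{k-1}$ for $k\ge1$, and let $\pi_k$ be greedy policies, $T^{\pi_k}V^k=TV^k$. Then there exists an integer $K\ge0$ such that $\mathcal P^{\pi_k}g^\star=g^\star$ for all $k\ge K$; taking $K$ to be the minimal such integer, for every $k>K$, \[\|g^\star-g^{\pi_k}\|_\infty\le\|TV^k-V^k-g^\star\|_\infty\le\frac{2\|V^0-h^\star\|_\infty}{\sqrt{\varpi\sum_{i=K+1}^k\lambda_i(1-\lambda_i)}},\] where $\varpi=3.141592\ldots$ is the circle constant.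
   Context: An MDP $(\mathcal S,\mathcal A,P,r)$ has finite state space $\mathcal S$ ($|\mathcal S|=n$, functions identified with $\mathbb R^n$), finite action space, transition probabilities $P(s'\mid s,a)$ and bounded reward $r$. For a policy $\pi$: $r^\pi(s)=\sum_a\pi(a\mid s)r(s,a)$, $\mathcal P^\pi(s,s')=\sum_a\pi(a\mid s)P(s'\mid s,a)$, $g^\pi(s)=\liminf_{T\to\infty}\frac1T\mathbb E_\pi[\sum_{t=0}^{T-1}r(s_t,a_t)\mid s_0=s]$, $g^\star=\max_\pi g^\pi$. $T^\pi V=r^\pi+\mathcal P^\pi V$, $(TV)(s)=\max_a\{r(s,a)+\sum_{s'}P(s'\mid s,a)V(s')\}$. A pair $(g,h)$ solves the modified Bellman equations if $\max_a\sum_{s'}P(s'\mid s,a)g(s')=g(s)$ and $\max_a\{r(s,a)+\sum_{s'}P(s'\mid s,a)h(s')\}=h(s)+g(s)$ for all $s$, with some policy attaining both maxima simultaneously; the first component of any solution equals $g^\star$. *)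

(* Defs.v *)
From HB Require Import structures.
From mathcomp Require Import all_boot all_order all_algebra.
From mathcomp Require Import all_classical all_reals all_analysis.
Set Implicit Arguments. Unset Strict Implicit. Unset Printing Implicit Defensive.
Import Order.TTheory GRing.Theory Num.Theory.
Local Open Scope ring_scope.

Section MDP.
Variables (R : realType) (S A : finType).
Variables (P : S -> A -> S -> R) (r : S -> A -> R).

Definition is_kernel : Prop :=
  (forall s a s', 0 <= P s a s') /\ (forall s a, \sum_(s' : S) P s a s' = 1).

Definition is_policy (pi : S -> A -> R) : Prop :=
  (forall s a, 0 <= pi s a) /\ (forall s, \sum_(a : A) pi s a = 1).

Definition rpi (pi : S -> A -> R) : S -> R :=
  fun s => \sum_(a : A) pi s a * r s a.

Definition Ppi (pi : S -> A -> R) (s s' : S) : R :=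
  \sum_(a : A) pi s a * P s a s'.

Definition Ppi_app (pi : S -> A -> R) (V : S -> R) : S -> R :=
  fun s => \sum_(s' : S) Ppi pi s s' * V s'.

Definition Tpi (pi : S -> A -> R) (V : S -> R) : S -> R :=
  fun s => rpi pi s + Ppi_app pi V s.

Definition maxA (f : A -> R) : R := fine (\big[maxe/-oo%E]_(a : A) (f a)%:E).

Definition Tbell (V : S -> R) : S -> R :=
  fun s => maxA (fun a => r s a + \sum_(s' : S) P s a s' * V s').

(* g^pi(s) = liminf_T 1/T E_pi[sum_{t<T} r(s_t,a_t) | s_0 = s]; for a stationary
   policy E_pi[r(s_t,a_t) | s_0 = s] = ((P^pi)^t r^pi)(s). *)
Definition gain (pi : S -> A -> R) (s : S) : R :=
  limn_inf (fun T : nat =>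
    T%:R^-1 * \sum_(t < T) iter t (Ppi_app pi) (rpi pi) s).

Definition modified_bellman (g h : S -> R) : Prop :=
  (forall s, maxA (fun a => \sum_(s' : S) P s a s' * g s') = g s) /\
  (forall s, Tbell h s = h s + g s) /\
  (exists pi, is_policy pi /\ Ppi_app pi g = g /\ Tpi pi h = h \+ g).

End MDP.

Definition supnorm (R : realType) (S : finType) (f : S -> R) : R :=
  \big[Num.max/0]_(s : S) `|f s|.

(* Main.v *)
(* Put L_k = \sum_(j <= k) (1 - lam_j), x_k = V^k - L_k g and
   y_k = T V^k - (L_k + 1) g.  Comparing with h + c g (c >= 0), on which T acts
   as c |-> c + 1, keeps x_k and y_k within M = |V^0 - h| of h.  As L_k -> oo, an
   action that does not preserve g is eventually not greedy, which gives K.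
   From K on, the greedy policies fix g, so |y_n - y_m| <= |x_n - x_m|, and
   x_(k+1) is a Krasnosel'skii-Mann average of x_k and y_k.

   The constant is that of Cominetti, Soto and Vaisman.  Unfolding the averages
   of x_n and y_n one step at a time dominates |y_m - x_m| / (2 M) by the
   probability that a lazy symmetric random walk with step probabilities
   p_i = lam_i (1 - lam_i) stays nonnegative; by reflection this is
   E sgn(1 + walk), that is
     1/pi \int_0^pi (1 + cos t) \prod_i (1 - 2 p_i (1 - cos t)) dt.
   With 1 - z <= exp(-z) and 1 + cos t <= 2 cos (t/2), the integral is at most
   that of 2 cos (t/2) exp(-4 sigma sin^2 (t/2)), sigma = \sum_i p_i, and the
   substitution u = sin (t/2) reduces it to a Gaussian integral.  Integrals over
   [0, pi] are handled through explicit primitives and monotonicity. *)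
Require Import Defs.
From HB Require Import structures.
From mathcomp Require Import all_boot all_order all_algebra.
From mathcomp Require Import all_classical all_reals all_analysis.
From mathcomp Require Import ring lra zify.
Import Order.TTheory GRing.Theory Num.Theory.
Import numFieldNormedType.Exports.
Local Open Scope ring_scope.

(** * Fourier analysis of the lazy walk and the Gaussian bound *)

(** Integrating from [-oo] makes every real [x] interior, so the fundamental theorem applies
    everywhere; [F y - F 0] is the half-line integral minus a nonnegative tail. *)
Lemma gauss_primitive (R : realType) :
  exists F : R -> R, (forall x : R, is_derive x 1 F (expR (- x ^+ 2))) /\
    (forall y, F y - F 0 <= Num.sqrt pi / 2).
Proof.
pose mu := @lebesgue_measure R.
pose F (y : R) := (\int[mu]_(t in [set` Interval -oo%O (BRight y)]) gauss_fun t)%R.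
have intI (D : set R) : measurable D ->
    mu.-integrable D (EFin \o (@gauss_fun R)).
  by move=> mD; apply: (integrableS measurableT) => //; exact: integrableT_gauss.
exists F; split=> [x|y].
  have [] := @continuous_FTC1 R (@gauss_fun R) -oo%O x (x + 1) _ _ _ _.
  - by rewrite ltrDl.
  - exact: intI.
  - exact: ltNyr.
  - exact: continuous_gauss_fun.
  - by rewrite derive1E => dF F'; apply: DeriveDef.
have tail (z : R) : (\int[mu]_(t in [set` `]-oo, +oo[]) gauss_fun t)%R - F z =
    (\int[mu]_(t in [set` `]z, +oo[]) gauss_fun t)%R.
  by apply: Rintegral_itvB => //; exact: intI.
have half : (\int[mu]_(t in [set` `]0%R, +oo[]) gauss_fun t)%R = Num.sqrt pi / 2.
  rewrite Rintegral_itv_obnd_cbnd; last exact: intI.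
  by rewrite /Rintegral integral0y_gauss.
rewrite -half -tail lerB // -subr_ge0 tail.
by apply: Rintegral_ge0 => // t _; exact: gauss_fun_ge0.
Qed.

(** Orthogonality of cosines, [A pi - A 0] standing for the integral over [0, pi]. *)
Lemma cos_primitive (R : realType) (d : int) :
  exists A : R -> R, [/\ A 0 = 0, A pi = pi * (d == 0)%:R &
    forall x : R, is_derive x 1 A (cos (d%:~R * x))].
Proof.
have [->|d0] := eqVneq d 0.
  exists id; split; rewrite ?mulr1 // => x.
  by rewrite mul0r cos0; exact: is_derive_id.
have dR : d%:~R != 0 :> R by rewrite intr_eq0.
exists (fun x => d%:~R^-1 * sin (d%:~R * x)); split.
- by rewrite mulr0 sin0 mulr0.
- have sinn (n : nat) : sin (n%:R * pi) = 0 :> R.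
    elim: n => [|n IH]; first by rewrite mul0r sin0.
    by rewrite -addn1 natrD mulrDl mul1r sinDpi IH oppr0.
  by case: d {d0 dR} => n; rewrite ?NegzE ?mulrNz ?mulNr ?sinN /= sinn ?oppr0 !mulr0.
- move=> x.
  apply: is_derive_eq.
  by rewrite !scaler1 /= /GRing.scale /= mulrC mulfK.
Qed.

(* walk_sgn p m d = E sgn(d + W), where W is the sum of the steps i < m of the
   walk, step i being +1 or -1 with probability p_i each and 0 otherwise. *)
Fixpoint walk_sgn {R : realType} (p : nat -> R) (m : nat) : int -> R :=
  if m is m'.+1 then
    fun d => p m' * (walk_sgn p m' (d + 1) + walk_sgn p m' (d - 1))
             + (1 - 2 * p m') * walk_sgn p m' d
  else fun d => (sgz d)%:~R.

Lemma walk_sgnN (R : realType) (p : nat -> R) m d :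
  walk_sgn p m (- d) = - walk_sgn p m d.
Proof.
elim: m d => [|m IH] d /=; first by rewrite sgzN mulrNz.
rewrite (_ : - d + 1 = - (d - 1)); last by ring.
rewrite (_ : - d - 1 = - (d + 1)); last by ring.
by rewrite !IH; ring.
Qed.

Lemma walk_sgn0 (R : realType) (p : nat -> R) m : walk_sgn p m 0 = 0.
Proof. by have := walk_sgnN _ p m 0; rewrite oppr0; lra. Qed.

(** Fourier inversion: [1 - 2 * p i * (1 - cos x)] is the characteristic function of one step, and
    multiplying by it acts on the cosines as the recursion of [walk_sgn] acts on [d]. The induction
    visits [d + 1] and [d - 1], hence the general [d]. *)
Lemma walk_primitive (R : realType) (p : nat -> R) (m : nat) (d : int) :
  exists A : R -> R,
  [/\ A 0 = 0, A pi = pi * (walk_sgn p m (d + 1) - walk_sgn p m d) &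
    forall x : R, is_derive x 1 A
      ((cos (d%:~R * x) + cos ((d + 1)%:~R * x)) *
       \prod_(i < m) (1 - 2 * p i * (1 - cos x)))].
Proof.
elim: m d => [|m IH] d.
  have [A [A0 Api dA]] := cos_primitive R d.
  have [B [B0 Bpi dB]] := cos_primitive R (d + 1).
  exists (fun x => A x + B x); split.
  - by rewrite A0 B0 addr0.
  - rewrite Api Bpi -mulrDr; congr (_ * _) => /=.
    (* The sign jumps by one from -1 to 0 and again from 0 to 1, whence two cosines in the
       integrand. *)
    have -> : (sgz (d + 1))%:~R = (sgz d)%:~R + ((d == 0) + (d + 1 == 0)%R)%N%:R :> R.
      rewrite pmulrn -intrD; congr (_%:~R).
      by case: d {A A0 Api dA B B0 Bpi dB} => [[|n]|[|n]].
    by rewrite natrD addrAC subrr add0r.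
  - by move=> x; rewrite big_ord0 mulr1; apply: is_deriveD.
have [A [A0 Api dA]] := IH d.
have [B [B0 Bpi dB]] := IH (d + 1).
have [C [C0 Cpi dC]] := IH (d - 1).
exists (fun x => (1 - 2 * p m) * A x + p m * (B x + C x)); split.
- by rewrite A0 B0 C0; ring.
- by rewrite Api Bpi Cpi /= !subrK !addrK; ring.
move=> x; apply: is_derive_eq.
rewrite /GRing.scale /= big_ord_recr /=.
set Q := \prod_(_ < _) _.
rewrite subrK.
have cosDB (e : int) : cos ((e + 1)%:~R * x) + cos ((e - 1)%:~R * x)
    = 2 * cos x * cos (e%:~R * x).
  by rewrite intrD intrB mulrDl mulrBl mul1r cosB cosD; ring.
have := cosDB d; have := cosDB (d + 1).
rewrite addrK => H1 H2.
have -> : cos ((d + 1 + 1)%:~R * x)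
     = 2 * cos x * cos ((d + 1)%:~R * x) - cos (d%:~R * x) by rewrite -H1; ring.
have -> : cos ((d - 1)%:~R * x)
     = 2 * cos x * cos (d%:~R * x) - cos ((d + 1)%:~R * x) by rewrite -H2; ring.
ring.
Qed.

Lemma walk_sgn1_le (R : realType) (p : nat -> R) (m : nat) :
  (forall i, 0 <= p i <= 1 / 4) -> 0 < \sum_(i < m) p i ->
  walk_sgn p m 1 <= (Num.sqrt (pi * \sum_(i < m) p i))^-1.
Proof.
move=> hp; set sg := \sum_(i < m) p i => sg0.
have [A [A0 Api dA]] := walk_primitive R p m 0.
have [F [dF F_le]] := gauss_primitive R.
pose c := Num.sqrt sg; have c0 : 0 < c by rewrite sqrtr_gt0.
have c2 : c ^+ 2 = sg by rewrite sqr_sqrtr // ltW.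
(* The substitution u = 2 c sin (t/2) turns the exponential into exp(-u^2), and the factor [2 / c]
   turns du = c cos (t/2) dt into 2 cos (t/2) dt. *)
pose B : R -> R := fun x => 2 / c * F (2 * c * sin (2^-1 * x)).
have dB (x : R) : is_derive x 1 B
    (2 * cos (2^-1 * x) * expR (- (4 * sg * sin (2^-1 * x) ^+ 2))).
  pose g : R -> R := fun y => 2 * c * sin (2^-1 * y).
  have dg : is_derive x 1 g (c * cos (2^-1 * x)).
    by apply: is_derive_eq; rewrite /GRing.scale /=; field.
  have d1 := is_derive1_comp (dF (g x)) dg.
  apply: (is_derive_eq (is_deriveZ (2 / c) d1)).
  rewrite /GRing.scale /= (_ : g x ^+ 2 = 4 * sg * sin (2^-1 * x) ^+ 2).
    by field; rewrite gt_eqF.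
  by rewrite -c2 /g; ring.
have dBA (x : R) := is_deriveB (dB x) (dA x).
have mono : (B - A) 0 <= (B - A) pi.
  apply: (@ger0_derive1_le_cc R (B - A) 0 pi); rewrite ?in_itv /= ?lexx ?pi_ge0 //.
  - move=> x; rewrite in_itv /= => /andP[x0 xpi].
    rewrite derive1E (@derive_val _ _ _ _ _ _ _ (dBA x)) subr_ge0 mul0r cos0 add0r mul1r.
    set s := sin (2^-1 * x); set k := cos (2^-1 * x).
    have cosx : cos x = 1 - 2 * s ^+ 2.
      rewrite (_ : x = 2^-1 * x + 2^-1 * x) ?cosD -/s -/k; last by field.
      have := cos2Dsin2 (2^-1 * x); rewrite -/s -/k => h; lra.
    have k0 : 0 <= k by apply: cos_ge0_pihalf; lra.
    have k1 : k <= 1 := cos_le1 _.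
    have ks : k ^+ 2 + s ^+ 2 = 1 := cos2Dsin2 _.
    rewrite (_ : 1 + cos x = 2 * k * k); last by rewrite cosx; lra.
    have prod_le : \prod_(i < m) (1 - 2 * p i * (1 - cos x)) <= expR (- (4 * sg * s ^+ 2)).
      rewrite /sg mulr_sumr mulr_suml -sumrN expR_sum.
      apply: ler_prod => i _; have /andP[p0 p1] := hp i.
      have s2 : s ^+ 2 <= 1 by rewrite -ks lerDr sqr_ge0.
      have s20 : 0 <= s ^+ 2 by exact: sqr_ge0.
      (* [p i <= 1 / 4] makes the factor 1 - 4 p_i s^2 nonnegative, as a factorwise comparison of
         products requires. *)
      rewrite cosx; apply/andP; split; first by nra.
      have := expR_ge1Dx (- (4 * p i * s ^+ 2)). lra.
    apply: (@le_trans _ _ (2 * k * k * expR (- (4 * sg * s ^+ 2)))).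
      by rewrite ler_wpM2l // !mulr_ge0.
    (* One factor [k <= 1] of 1 + cos x = 2 k^2 is given up; the other serves the substitution. *)
    by rewrite ler_wpM2r ?expR_ge0 // ler_piMr // mulr_ge0.
  - by apply: derivable_within_continuous => x _.
have {}mono : B 0 - A 0 <= B pi - A pi := mono.
move: mono; rewrite A0 subr0 Api !add0r walk_sgn0 subr0 /B mulr0 sin0 mulr0.
rewrite [2^-1 * pi]mulrC sin_pihalf mulr1 => mono.
have pi0 : 0 < pi :> R := pi_gt0 R.
have q0 : 0 < Num.sqrt pi :> R by rewrite sqrtr_gt0.
have q2 : Num.sqrt pi ^+ 2 = pi :> R by rewrite sqr_sqrtr // ltW.
rewrite sqrtrM ?pi_ge0 // -/c.
have {mono} : pi * walk_sgn p m 1 <= Num.sqrt pi / c.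
  have c'0 : 0 <= 2 / c by rewrite divr_ge0 // ltW.
  have /(ler_wpM2l c'0) := F_le (2 * c).
  rewrite (_ : 2 / c * (Num.sqrt pi / 2) = Num.sqrt pi / c); last by field; rewrite gt_eqF.
  lra.
rewrite -ler_pdivlMl // => /le_trans -> //.
rewrite -[X in X^-1 * _]q2 expr2 le_eqVlt; apply/orP; left; apply/eqP; field.
by rewrite !gt_eqF.
Qed.

(** * Domination of averaged iterations by the walk *)

(* The value walk_sgn with p_i = a_i (1 - a_i), averaged over a starting point
   d + B_m + ... + B_(m + t - 1) with independent Bernoulli(a_i) variables B_i. *)
Fixpoint race {R : realType} (a : nat -> R) (m t : nat) : int -> R :=
  if t is t'.+1 then
    fun d => (1 - a (m + t')%N) * race a m t' d
             + a (m + t')%N * race a m t' (d + 1)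
  else walk_sgn (fun i => a i * (1 - a i)) m.

(* A step of the walk is B_m - B'_m with B_m, B'_m independent copies of
   Bernoulli(a_m); B_m joins the starting point and B'_m is integrated here. *)
Lemma raceS (R : realType) (a : nat -> R) m t d :
  race a m.+1 t d = (1 - a m) * race a m t.+1 d + a m * race a m t.+1 (d - 1).
Proof.
elim: t d => [|t IH] d; first by rewrite /= addn0 subrK; ring.
rewrite [LHS]/= !IH.
rewrite (_ : race a m t.+2 = fun e : int => (1 - a (m + t.+1)%N) * race a m t.+1 e
             + a (m + t.+1)%N * race a m t.+1 (e + 1)) //.
rewrite subrK addrK addSnnS; ring.
Qed.

(** Without walk steps only the Bernoulli variables remain, and they cannot take a positive start
    below 1. *)
Lemma race0 (R : realType) (a : nat -> R) t (n : nat) : race a 0 t n.+1 = 1.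
Proof.
elim: t n => [|t IH] n /=; first by rewrite /sgz.
by rewrite -PoszD addn1 !IH; ring.
Qed.

(** Two nested inductions reproduce the recursions of [race]. For fixed m, unfolding x_(m+t+1)
    bounds |x_(m+t) - x_m| by [D * race a m t 0]; unfolding x_(m+1) and applying [hy] to that bound
    leads from m to m + 1 through [raceS]. *)
Lemma km_race_bound (R : realType) (S : Type) (a : nat -> R) (x y : nat -> S -> R) (D : R) :
  (forall i, 0 <= a i <= 1) ->
  (forall i s, x i.+1 s = (1 - a i) * x i s + a i * y i s) ->
  (forall n m c, (forall s, `|x n s - x m s| <= c) -> forall s, `|y n s - y m s| <= c) ->
  (forall n s, `|y n s - x 0%N s| <= D) ->
  forall m t s,
    `|y (m + t)%N s - x m s| <= D * race a m t 1.
Proof.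
move=> ha hx hy hD.
have hE m : (forall t s, `|y (m + t)%N s - x m s| <= D * race a m t 1) ->
    forall t s, `|x (m + t)%N s - x m s| <= D * race a m t 0.
  move=> hF; elim=> [|t IH] s.
    by rewrite addn0 subrr normr0 /= walk_sgn0 mulr0.
  have /andP[a0 a1] := ha (m + t)%N.
  rewrite addnS hx /= add0r.
  rewrite (_ : _ - _ = (1 - a (m + t)%N) * (x (m + t)%N s - x m s) +
      a (m + t)%N * (y (m + t)%N s - x m s)); last by ring.
  rewrite (le_trans (ler_normD _ _)) // !normrM.
  rewrite (ger0_norm a0) (@ger0_norm _ (1 - _)); last by rewrite subr_ge0.
  rewrite mulrDr 2!(mulrCA D) lerD // ler_wpM2l // ?subr_ge0 //.
elim=> [|m IH] t s; first by rewrite race0 mulr1 hD.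
have /andP[a0 a1] := ha m.
rewrite raceS subrr hx.
rewrite (_ : _ - _ = (1 - a m) * (y (m.+1 + t)%N s - x m s) +
    a m * (y (m.+1 + t)%N s - y m s)); last by ring.
rewrite (le_trans (ler_normD _ _)) // !normrM.
rewrite (ger0_norm a0) (@ger0_norm _ (1 - _)); last by rewrite subr_ge0.
rewrite mulrDr 2!(mulrCA D) addSnnS lerD // ler_wpM2l // ?subr_ge0 //.
exact/hy/hE.
Qed.

(** * Sup norm, attained maxima, lower and upper limits *)

Lemma supnorm_ge (R : realType) (S : finType) (f : S -> R) s : `|f s| <= supnorm f.
Proof. exact: le_bigmax. Qed.

Lemma supnorm_ge0 (R : realType) (S : finType) (f : S -> R) : 0 <= supnorm f.
Proof. exact: bigmax_ge_id. Qed.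

Lemma supnorm_le (R : realType) (S : finType) (f : S -> R) c :
  0 <= c -> (forall s, `|f s| <= c) -> supnorm f <= c.
Proof. by move=> c0 h; apply: bigmax_le. Qed.

(** The maximum is taken in the extended reals from [-oo]; a nonempty [A] ensures that [fine] reads
    off a real value. *)
Lemma maxA_attained (R : realType) (A : finType) (f : A -> R) :
  (0 < #|A|)%N -> exists2 a, Defs.maxA f = f a & forall b, f b <= f a.
Proof.
move=> /card_gt0P[a0 _].
have [//|b _|a _ ha] := @eq_bigmax _ _ _ -oo%E a0 predT (fun a => (f a)%:E).
  by rewrite leNye.
exists a => [|b]; first by rewrite /Defs.maxA ha.
by rewrite -lee_fin -ha; exact: (le_bigmax _ (fun b => (f b)%:E)).
Qed.

Lemma maxA_ge (R : realType) (A : finType) (f : A -> R) a :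
  (0 < #|A|)%N -> f a <= Defs.maxA f.
Proof. by move=> /(maxA_attained _ _ f)[b -> ->]. Qed.

(** Meant for time averages with an error of order 1/T: infima of late tails stay above l - d - e,
    and each tail contains a late term below l + d + e. *)
Lemma limn_inf_dist (R : realType) (u : nat -> R) (l d C : R) :
  (forall n, (0 < n)%N -> `|u n - l| <= d + C / n%:R) -> `|limn_inf u - l| <= d.
Proof.
move=> hu.
have C0 : 0 <= d + `|C|.
  have := hu 1%N isT; rewrite divr1; have := ler_norm C; have := normr_ge0 (u 1%N - l); lra.
have ub n : `|u n| <= `|u 0%N| + `|l| + (d + `|C|).
  case: n => [|n]; first by rewrite -addrA lerDl addr_ge0.
  have h := hu n.+1 isT.
  have : C / n.+1%:R <= `|C|.
    rewrite ler_pdivrMr ?ltr0Sn // (le_trans (ler_norm C)) // ler_peMr // ler1n //.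
  have := ler_normD (u n.+1 - l) l; rewrite subrK; have := normr_ge0 (u 0%N).
  move: h; set q := C / _; lra.
have bu : bounded_fun u.
  exists (`|u 0%N| + `|l| + (d + `|C|)); split; first exact: num_real.
  by move=> x /ltW hx n _; exact: le_trans (ub n) hx.
have hub := bounded_fun_has_ubound_infs bu.
have lbn n := has_lbound_sdrop (bounded_fun_has_lbound bu) n.
rewrite limn_infE //; set L := sup _.
have sm (e : R) : 0 < e -> exists N : nat, forall n, (N < n)%N -> C / n%:R <= e.
  move=> e0; exists (Num.truncn (`|C| / e)) => n hn.
  have n0 : 0 < n%:R :> R by rewrite ltr0n; lia.
  rewrite ler_pdivrMr // (le_trans (ler_norm C)) // -ler_pdivrMl // mulrC ltW //.
  by rewrite -truncn_lt_nat // divr_ge0 // ltW.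
rewrite ler_distl; apply/andP; split; apply/ler_addgt0Pr => e e0; have [N hN] := sm e e0.
- have : infs u N.+1 <= L by apply: ub_le_sup => //; exists N.+1.
  move=> /(le_trans _) hL; rewrite -lerBlDr; apply: hL.
  apply: lb_le_inf; first by exists (u N.+1); exists N.+1 => /=.
  move=> _ [n /= hn <-].
  have := hu n (leq_ltn_trans (leq0n _) hn); have := hN n hn.
  rewrite ler_distl => h /andP[]; lra.
- apply: ge_sup; first by exists (infs u 0%N); exists 0%N.
  move=> _ [n _ <-]; pose m := (maxn n N.+1).
  have : infs u n <= u m by apply: ge_inf => //; exists m => //=; rewrite /m leq_maxl.
  have hm : (N < m)%N by rewrite /m leq_maxr.
  have := hu m (leq_ltn_trans (leq0n _) hm); have := hN m hm.
  rewrite ler_distl => h /andP[]; lra.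
Qed.

Lemma limn_sup_lt (R : realType) (u : nat -> R) (c : R) :
  bounded_fun u -> limn_sup u < c ->
  exists2 b, b < c & exists N, forall n, (N <= n)%N -> u n <= b.
Proof.
move=> bu; rewrite limn_supE // => /inf_lt[].
  by exists (sups u 0%N); exists 0%N.
move=> _ [N _ <-] hN; exists (sups u N) => //; exists N => n hn.
apply: ub_le_sup; last by exists n.
exact/has_ubound_sdrop/bounded_fun_has_ubound.
Qed.

(** Eventually [lam] stays below some b < 1, so every further term adds at least 1 - b. *)
Lemma sum_gap_unbounded (R : realType) (lam : nat -> R) :
  (forall j, (1 <= j)%N -> 0 < lam j < 1) -> limn_sup lam < 1 ->
  forall X, exists N, forall k, (N <= k)%N -> X < \sum_(j < k) (1 - lam j.+1).
Proof.
move=> hlam hsup X.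
have bl : bounded_fun lam.
  exists (`|lam 0%N| + 1); split; first exact: num_real.
  move=> b /ltW hb [|j] _; apply: le_trans hb; first by rewrite lerDl.
  have /andP[l0 l1] := hlam j.+1 isT.
  by rewrite gtr0_norm //; have := normr_ge0 (lam 0%N); lra.
have [b b1 [N hN]] := limn_sup_lt _ _ _ bl hsup.
have grow m : m%:R * (1 - b) <= \sum_(j < N + m) (1 - lam j.+1).
  elim: m => [|m IH].
    by rewrite mul0r sumr_ge0 // => j _; have := hlam j.+1 isT; lra.
  rewrite addnS big_ord_recr -natr1 mulrDl mul1r lerD // lerD2l lerN2 hN //.
  by rewrite ltnW // ltnS leq_addr.
exists (N + (Num.truncn (`|X| / (1 - b))).+1)%N => k hk.
rewrite -(subnKC (leq_trans (leq_addr _ N) hk)); apply: lt_le_trans (grow _).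
rewrite (le_lt_trans (ler_norm X)) // -ltr_pdivrMr ?subr_gt0 //.
rewrite -truncn_lt_nat ?divr_ge0 ?subr_ge0 ?(ltW b1) //.
by rewrite ltn_subRL (leq_trans _ hk) // addnS.
Qed.

Lemma wavg_le (R : realType) (I : finType) (w f : I -> R) c :
  (forall i, 0 <= w i) -> \sum_i w i = 1 -> (forall i, f i <= c) ->
  \sum_i w i * f i <= c.
Proof.
move=> w0 w1 hf; rewrite -[c]mul1r -w1 mulr_suml.
by apply: ler_sum => i _; rewrite ler_wpM2l.
Qed.

Lemma wavg_norm_le (R : realType) (I : finType) (w f : I -> R) c :
  (forall i, 0 <= w i) -> \sum_i w i = 1 -> (forall i, `|f i| <= c) ->
  `|\sum_i w i * f i| <= c.
Proof.
move=> w0 w1 hf; rewrite (le_trans (ler_norm_sum _ _ _)) //.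
under eq_bigr => i _ do rewrite normrM (ger0_norm (w0 i)).
exact: wavg_le.
Qed.

(** * Policy evaluation and Bellman operators *)

Section PolicyOperators.
Context {R : realType} {S A : finType} (P : S -> A -> S -> R) (r : S -> A -> R).
Context (hP : is_kernel P) (hA : (0 < #|A|)%N).

Lemma Ppi_appE q (W : S -> R) s :
  Ppi_app P q W s = \sum_a q s a * \sum_s' P s a s' * W s'.
Proof.
rewrite /Ppi_app /Ppi; under eq_bigr => s' _ do rewrite mulr_suml.
rewrite exchange_big; apply: eq_bigr => a _; rewrite mulr_sumr.
by apply: eq_bigr => s' _; rewrite mulrA.
Qed.

Lemma TpiE q (W : S -> R) s :
  Tpi P r q W s = \sum_a q s a * (r s a + \sum_s' P s a s' * W s').
Proof.
rewrite /Tpi Ppi_appE /rpi -big_split /=.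
by apply: eq_bigr => a _; rewrite mulrDr.
Qed.

Lemma Tbell_ge (W : S -> R) s a :
  r s a + \sum_s' P s a s' * W s' <= Tbell P r W s.
Proof. exact: (maxA_ge _ _ (fun a => r s a + _)). Qed.

Lemma Tpi_le_Tbell q (W : S -> R) s : is_policy q ->
  Tpi P r q W s <= Tbell P r W s.
Proof. by case=> q0 q1; rewrite TpiE; apply: wavg_le => // a; exact: Tbell_ge. Qed.

Lemma Ppi_appD q (U W : S -> R) :
  Ppi_app P q (fun s => U s + W s) = fun s => Ppi_app P q U s + Ppi_app P q W s.
Proof.
apply/funext => s; rewrite /Ppi_app -big_split /=.
by apply: eq_bigr => s' _; rewrite mulrDr.
Qed.

Lemma Ppi_appZ q c (W : S -> R) :
  Ppi_app P q (fun s => c * W s) = fun s => c * Ppi_app P q W s.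
Proof.
apply/funext => s; rewrite /Ppi_app mulr_sumr.
by apply: eq_bigr => s' _; rewrite mulrCA.
Qed.

Lemma Ppi_appB q (U W : S -> R) :
  Ppi_app P q (fun s => U s - W s) = fun s => Ppi_app P q U s - Ppi_app P q W s.
Proof.
have -> : (fun s => U s - W s) = fun s => U s + (-1) * W s.
  by apply/funext => s; rewrite mulN1r.
by rewrite Ppi_appD Ppi_appZ; apply/funext => s; rewrite mulN1r.
Qed.

Lemma Ppi_app_norm_le q (W : S -> R) c : is_policy q ->
  (forall s, `|W s| <= c) -> forall s, `|Ppi_app P q W s| <= c.
Proof.
case: hP => P0 P1 [q0 q1] hW s; rewrite Ppi_appE.
by apply: wavg_norm_le => // a; exact: wavg_norm_le.
Qed.

Lemma Ppi_app_iter_norm_le q (W : S -> R) c t : is_policy q ->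
  (forall s, `|W s| <= c) -> forall s, `|iter t (Ppi_app P q) W s| <= c.
Proof.
by move=> hq hW; elim: t => [|t IH] //=; exact: Ppi_app_norm_le.
Qed.

(** With d = T^q W - W - g, the reward is r^q = W - P^q W + g + d; applying (P^q)^t and summing
    telescopes, since P^q fixes g. The boundary term W - (P^q)^T W costs at most 2 |W| / T after
    averaging. *)
Lemma gain_dist q (g W : S -> R) c : is_policy q -> Ppi_app P q g = g ->
  (forall s, `|Tpi P r q W s - W s - g s| <= c) ->
  forall s, `|gain P r q s - g s| <= c.
Proof.
move=> hq hg; set d := fun s => Tpi P r q W s - W s - g s => hd s.
pose p := Ppi_app P q.
have rE t : iter t p (rpi r q) =
    fun s => iter t p W s + g s + iter t p d s - iter t.+1 p W s.
  elim: t => [|t IH] /=; first by apply/funext => x; rewrite /d /Tpi /p; ring.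
  by rewrite IH /p Ppi_appB !Ppi_appD hg.
have sumE T : \sum_(t < T) iter t p (rpi r q) s =
    W s - iter T p W s + T%:R * g s + \sum_(t < T) iter t p d s.
  elim: T => [|T IH]; first by rewrite !big_ord0 /=; ring.
  by rewrite !big_ord_recr /= IH rE -natr1 /=; ring.
apply: (@limn_inf_dist _ _ _ _ (2 * supnorm W)) => T T0.
have TR : 0 < T%:R :> R by rewrite ltr0n.
rewrite -/p sumE.
rewrite (_ : _ - g s = (W s - iter T p W s + \sum_(t < T) iter t p d s) / T%:R).
  rewrite normrM normfV (ger0_norm (ltW TR)) ler_pdivrMr // mulrDl divfK ?gt_eqF //.
  have h1 := supnorm_ge _ _ W s.
  have h2 := Ppi_app_iter_norm_le q W _ T hq (supnorm_ge _ _ W) s.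
  have h3 : `|\sum_(t < T) iter t p d s| <= c * T%:R.
    rewrite (le_trans (ler_norm_sum _ _ _)) // mulr_natr.
    rewrite -[X in _ *+ X]card_ord -sumr_const; apply: ler_sum => t _.
    exact: Ppi_app_iter_norm_le.
  rewrite (le_trans (ler_normD _ _)) // addrC lerD //.
  by rewrite (le_trans (ler_normB _ _)) // mulrDl mul1r lerD.
by field; rewrite gt_eqF.
Qed.

(** From below, compare with the policy [q] attaining both maxima; from above, with a maximizing
    action [a], for which P g <= g may be multiplied by [c >= 0]. *)
Lemma Tbell_drift (g h W : S -> R) c M : modified_bellman P r g h -> 0 <= c ->
  (forall s, `|W s - h s - c * g s| <= M) ->
  forall s, `|Tbell P r W s - h s - (c + 1) * g s| <= M.
Proof.
move=> [hg [hh [q [hq [qg qh]]]]] c0 hW s.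
have Wdec : W = fun s => h s + (c * g s + (W s - h s - c * g s)).
  by apply/funext => x; ring.
rewrite ler_norml; apply/andP; split.
  have : Tpi P r q W s <= Tbell P r W s by exact: Tpi_le_Tbell.
  have := congr1 (fun f => f s) qh; rewrite /= /Tpi => qhs.
  rewrite [X in Ppi_app P q X]Wdec 2!Ppi_appD Ppi_appZ qg.
  have := Ppi_app_norm_le q _ _ hq hW s; rewrite ler_norml => /andP[]. lra.
have [a Ta _] := maxA_attained _ _ (fun a => r s a + \sum_s' P s a s' * W s') hA.
rewrite {1}/Tbell Ta.
have ga : \sum_s' P s a s' * g s' <= g s.
  by rewrite -[leRHS]hg; exact: (maxA_ge _ _ (fun a => \sum_s' P s a s' * g s')).
have := Tbell_ge h s a; rewrite hh.
have -> : \sum_s' P s a s' * W s' = \sum_s' P s a s' * h s' +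
   (c * (\sum_s' P s a s' * g s') + \sum_s' P s a s' * (W s' - h s' - c * g s')).
  by rewrite mulr_sumr -!big_split /=; apply: eq_bigr => s' _; ring.
have : \sum_s' P s a s' * (W s' - h s' - c * g s') <= M.
  case: hP => P0 P1; apply: wavg_le => // s'; exact: le_trans (ler_norm _) (hW s').
have := ler_wpM2l c0 ga; lra.
Qed.

(** A greedy policy averages the nonnegative gaps to zero, so each gap with positive weight
    vanishes. *)
Lemma greedy_inactive q (W : S -> R) s a : is_policy q -> Tpi P r q W = Tbell P r W ->
  r s a + \sum_s' P s a s' * W s' < Tbell P r W s -> q s a = 0.
Proof.
move=> [q0 q1] hq hlt.
have gap0 : \sum_b q s b * (Tbell P r W s - (r s b + \sum_s' P s b s' * W s')) = 0.
  under eq_bigr => b _ do rewrite mulrBr.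
  by rewrite sumrB -TpiE hq -mulr_suml q1 mul1r subrr.
have := psumr_eq0P _ gap0 => /(_ _ a isT) /eqP.
rewrite mulf_eq0 subr_eq0 [Tbell _ _ _ _ == _]gt_eqF // orbF => H; apply/eqP/H => b _.
by rewrite mulr_ge0 // subr_ge0 Tbell_ge.
Qed.

(** Since [q] is greedy at [U] and admissible at [W], T U - T W <= P^q (U - W), and P^q leaves (b -
    c) g unchanged. Exchanging [U] and [W] gives the other side. *)
Lemma greedy_nonexpansive q (g U W : S -> R) b c M : is_policy q ->
  Ppi_app P q g = g -> Tpi P r q U = Tbell P r U ->
  (forall s, `|(U s - b * g s) - (W s - c * g s)| <= M) ->
  forall s, Tbell P r U s - Tbell P r W s - (b - c) * g s <= M.
Proof.
move=> hq hg hU hUW s.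
have := Ppi_app_norm_le q _ _ hq hUW s => /(le_trans (ler_norm _)).
rewrite !Ppi_appB !Ppi_appZ hg.
have := Tpi_le_Tbell q W s hq; rewrite -hU /Tpi; lra.
Qed.

End PolicyOperators.

(** * Drift bound, eventual invariance of [gs], and the rate *)

Theorem theorem8 (R : realType) (S A : finType)
  (P : S -> A -> S -> R) (r : S -> A -> R)
  (hA : (0 < #|A|)%N) (hP : is_kernel P)
  (gs hs : S -> R) (hB : modified_bellman P r gs hs)
  (lam : nat -> R) (hlam : forall j, (1 <= j)%N -> 0 < lam j < 1)
  (hlimsup : limn_sup lam < 1)
  (V : nat -> S -> R)
  (hV : forall k, (1 <= k)%N ->
     V k = (fun s => lam k * V k.-1 s + (1 - lam k) * Tbell P r (V k.-1) s))
  (pol : nat -> S -> A -> R)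
  (hpol : forall k, is_policy (pol k))
  (hgreedy : forall k, Tpi P r (pol k) (V k) = Tbell P r (V k)) :
  (exists K : nat, forall k, (K <= k)%N -> Ppi_app P (pol k) gs = gs) /\
  (forall K : nat,
     (forall k, (K <= k)%N -> Ppi_app P (pol k) gs = gs) ->
     (forall K' : nat, (forall k, (K' <= k)%N -> Ppi_app P (pol k) gs = gs) ->
        (K <= K')%N) ->
     forall k, (K < k)%N ->
       supnorm (fun s => gs s - gain P r (pol k) s)
         <= supnorm (fun s => Tbell P r (V k) s - V k s - gs s) /\
       supnorm (fun s => Tbell P r (V k) s - V k s - gs s)
         <= 2 * supnorm (fun s => V 0%N s - hs s) /
            Num.sqrt (pi * \sum_(K.+1 <= i < k.+1) lam i * (1 - lam i))).
Proof.
set M := supnorm (fun s => V 0%N s - hs s).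
pose L k := \sum_(j < k) (1 - lam j.+1).
have LS k : L k.+1 = L k + (1 - lam k.+1) by rewrite /L big_ord_recr.
have L0 k : 0 <= L k.
  by apply: sumr_ge0 => j _; have := hlam j.+1 isT; lra.
have VS k s : V k.+1 s = lam k.+1 * V k s + (1 - lam k.+1) * Tbell P r (V k) s.
  by rewrite hV.
have drift k : forall s, `|V k s - hs s - L k * gs s| <= M.
  elim: k => [|k IH] s.
    by rewrite /L big_ord0 mul0r subr0; exact: (supnorm_ge _ _ (fun s => V 0%N s - hs s)).
  have /andP[l0 l1] := hlam k.+1 isT.
  have hT := Tbell_drift P r hP hA gs hs (V k) (L k) M hB (L0 k) IH s.
  (* The offsets average alike: lam L + (1 - lam) (L + 1) = L + (1 - lam). *)
  rewrite VS LS (_ : _ - _ - _ = lam k.+1 * (V k s - hs s - L k * gs s) +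
      (1 - lam k.+1) * (Tbell P r (V k) s - hs s - (L k + 1) * gs s)); last by ring.
  rewrite (le_trans (ler_normD _ _)) // !normrM (gtr0_norm l0).
  rewrite (@gtr0_norm _ (1 - _)) ?subr_gt0 //.
  have := ler_wpM2l (ltW l0) (IH s).
  have := ler_wpM2l (_ : 0 <= 1 - lam k.+1) hT; rewrite subr_ge0 (ltW l1) => /(_ isT).
  lra.
have driftT k s : `|Tbell P r (V k) s - hs s - (L k + 1) * gs s| <= M.
  exact: Tbell_drift.
split.
  have L_unbounded X : exists N, forall k, (N <= k)%N -> X < L k.
    exact: sum_gap_unbounded.
  have bad_inactive (sa : S * A) : exists N, forall k, (N <= k)%N ->
      \sum_s' P sa.1 sa.2 s' * gs s' < gs sa.1 -> pol k sa.1 sa.2 = 0.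
    case: sa => s a /=.
    have [glt|] := ltP (\sum_s' P s a s' * gs s') (gs s); last by exists 0%N.
    set G := \sum_s' _ in glt *; set H := \sum_s' P s a s' * hs s'.
    (* The action is worth at most r + H + L G + M, while T V^k >= h + (L + 1) g - M; beyond this
       threshold for L the first is strictly smaller. *)
    have [N hN] := L_unbounded ((r s a + H + 2 * M - hs s - gs s) / (gs s - G)).
    exists N => k /hN; rewrite ltr_pdivrMr ?subr_gt0 // => hL _.
    apply: (greedy_inactive P r hA (pol k) (V k)) => //.
    have -> : \sum_s' P s a s' * V k s' = H + (L k * G +
        \sum_s' P s a s' * (V k s' - hs s' - L k * gs s')).
      by rewrite /G /H mulr_sumr -!big_split /=; apply: eq_bigr => s' _; ring.
    have : \sum_s' P s a s' * (V k s' - hs s' - L k * gs s') <= M.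
      case: hP => P0 P1; apply: wavg_le => // s'; exact: le_trans (ler_norm _) (drift k s').
    have := driftT k s; rewrite ler_norml => /andP[]; lra.
  have [N hN] := choice bad_inactive.
  exists (\max_sa N sa)%N => k hk; apply/funext => s.
  case: (hpol k) => _ q1; rewrite Ppi_appE -[RHS]mul1r -(q1 s) mulr_suml.
  apply: eq_bigr => a _.
  (* Every action has P g <= g; those with strict inequality now carry weight zero, so only
     equalities are averaged. *)
  have Pg : \sum_s' P s a s' * gs s' <= gs s.
    case: hB => hg _; rewrite -[leRHS]hg.
    exact: (maxA_ge _ _ (fun a => \sum_s' P s a s' * gs s')).
  move: Pg; rewrite le_eqVlt => /predU1P[->//|Plt].
  have := hN (s, a) k (leq_trans (leq_bigmax (s, a)) hk) Plt.
  by rewrite /= => ->; rewrite !mul0r.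
move=> K hK _ k hk; split.
  apply: supnorm_le => [|s]; first exact: supnorm_ge0.
  rewrite distrC; apply: (gain_dist P r hP _ gs (V k)) => //; first exact/hK/ltnW.
  move=> x; rewrite hgreedy.
  exact: (supnorm_ge _ _ (fun s => Tbell P r (V k) s - V k s - gs s)).
(* Time restarts at K, and [a i] is the weight of T V^(K+i) in V^(K+i+1). *)
pose a i := 1 - lam (K + i).+1.
pose x i s := V (K + i)%N s - L (K + i)%N * gs s.
pose y i s := Tbell P r (V (K + i)%N) s - (L (K + i)%N + 1) * gs s.
have a01 i : 0 <= a i <= 1 by have := hlam (K + i).+1 isT; rewrite /a; lra.
have xS i s : x i.+1 s = (1 - a i) * x i s + a i * y i s.
  by rewrite /x /y /a addnS VS LS; ring.
have greedyK i : Ppi_app P (pol (K + i)%N) gs = gs by apply: hK; rewrite leq_addr.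
have nonexp n m c : (forall s, `|x n s - x m s| <= c) ->
    forall s, `|y n s - y m s| <= c.
  move=> hxc s; have hxc' s' : `|x m s' - x n s'| <= c by rewrite distrC.
  have := greedy_nonexpansive P r hP hA _ gs _ _ _ _ c (hpol _) (greedyK n) (hgreedy _) hxc s.
  have := greedy_nonexpansive P r hP hA _ gs _ _ _ _ c (hpol _) (greedyK m) (hgreedy _) hxc' s.
  by rewrite ler_norml /y => *; apply/andP; split; lra.
have yx0 n s : `|y n s - x 0%N s| <= 2 * M.
  have := driftT (K + n)%N s; have := drift (K + 0)%N s.
  rewrite /y /x !ler_norml => /andP[? ?] /andP[? ?]; apply/andP; split; lra.
have -> : \sum_(K.+1 <= i < k.+1) lam i * (1 - lam i)
    = \sum_(i < k - K) a i * (1 - a i).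
  rewrite -{1}[K.+1]add0n big_addn subSS big_mkord; apply: eq_bigr => i _.
  by rewrite /a addnS [(i + K)%N]addnC; ring.
have M0 : 0 <= M := supnorm_ge0 _ _ _.
apply: supnorm_le => [|s]; first by rewrite divr_ge0 ?mulr_ge0 ?sqrtr_ge0.
(* With t = 0 the race is the plain walk started at 1, run for k - K steps. *)
have := km_race_bound _ _ _ _ _ _ a01 xS nonexp yx0 (k - K)%N 0%N s.
rewrite addn0 /x /y subnKC ?(ltnW hk) //.
rewrite (_ : _ - _ - _ = Tbell P r (V k) s - V k s - gs s); last by ring.
move=> /le_trans; apply; rewrite ler_wpM2l ?mulr_ge0 //.
apply: walk_sgn1_le => [i|].
  have /andP[a0 a1] := a01 i; have -> /= : 0 <= a i * (1 - a i) by rewrite mulr_ge0 // subr_ge0.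
  by have := sqr_ge0 (a i - 1 / 2); lra.
(* k > K supplies a first term, positive because 0 < lam < 1, so the sum under the root is
   positive. *)
have kK : (0 < k - K)%N by rewrite subn_gt0.
rewrite (bigD1 (Ordinal kK)) //= ltr_pwDl //.
  have := hlam (K + 0).+1 isT; rewrite /a => /andP[l0 l1].
  by rewrite mulr_gt0 // subr_gt0 // gtrBl.
apply: sumr_ge0 => i _; have /andP[? ?] := a01 i.
by rewrite mulr_ge0 // subr_ge0.
Qed.
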